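(* For every graph $G$ with $n$ vertices and $m$ edges, the spanning tree polytope of $G$ has an extended formulation of size $O(mn)$ (with an absolute constant hidden in $O$).
   Context: Graphs are finite, simple and undirected. The spanning tree polytope of $G=(V,E)$ is the convex hull in $\mathbb{R}^{E}$ of the characteristic vectors $\chi^{E(T)}$ of the edge sets of spanning trees $T$ of $G$. An extended formulation of a polytope $P\subseteq\mathbb{R}^d$ is a description of a polyhedron $Q\subseteq\mathbb{R}^e$ by linear inequalities and equations, together with a linear map $\pi:\mathbb{R}^e\to\mathbb{R}^d$ with $\pi(Q)=P$; its size is the number of inequalities (equations and variables are not counted). *)

(* Defs.v *)
From HB Require Import structures.
From mathcomp Require Import all_boot all_order all_algebra.
From mathcomp Require Import classical_sets reals.

Set Implicit Arguments.
Unset Strict Implicit.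
Unset Printing Implicit Defensive.

Import Order.TTheory GRing.Theory Num.Theory.
Local Open Scope ring_scope.
Local Open Scope classical_set_scope.

Record sgraph := SGraph {
  vertex :> finType;
  adj : rel vertex;
  adj_sym : symmetric adj;
  adj_irrefl : irreflexive adj }.

Definition edges (G : sgraph) : {set {set G}} :=
  finset (fun e : {set G} =>
    [exists x, exists y, adj x y && (e == [set x; y]%SET)]).

Notation edge G := {e : {set vertex G} | e \in edges G}.

(* Adjacency in the spanning subgraph (V(G), F). *)
Definition adj_in (G : sgraph) (F : {set edge G}) : rel G :=
  fun x y => [exists e in F, val e == [set x; y]%SET].

(* The next three definitions are meant for symmetric irreflexive relations,
   seen as simple graphs.  For those, ucycle also accepts the sequences [::]
   and [:: x; y] with x, y adjacent; the graph cycles are exactly the ucycles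
   of size at least 3.  As usual, a connected graph is nonempty. *)
Definition connected_graph (T : finType) (r : rel T) : Prop :=
  (0 < #|T|)%N /\ forall x y, connect r x y.

Definition acyclic_graph (T : finType) (r : rel T) : Prop :=
  forall c : seq T, ucycle r c -> (size c < 3)%N.

Definition is_tree (T : finType) (r : rel T) : Prop :=
  connected_graph r /\ acyclic_graph r.

(* Spanning trees of G, identified with their edge sets. *)
Definition spanning_trees (G : sgraph) : set {set edge G} :=
  [set F | is_tree (adj_in F)].

(* The space R^E; R^o makes it an lmodType over R. *)
Notation edge_space R G := {ffun edge G -> R^o}.

Definition charvec (R : realType) (G : sgraph) (F : {set edge G}) :
  edge_space R G := [ffun e => (e \in F)%:R].

Definition convex_hull (R : realType) (V : lmodType R) (S : set V) : set V :=
  [set x | exists (k : nat) (w : 'I_k -> R) (p : 'I_k -> V),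
    [/\ forall i, 0 <= w i,
        \sum_(i < k) w i = 1,
        forall i, S (p i)
      & x = \sum_(i < k) w i *: p i]].

Definition spanning_tree_polytope (R : realType) (G : sgraph) :
  set (edge_space R G) :=
  convex_hull (@charvec R G @` @spanning_trees G).

(* The system  A y <= b, B y = c  together with the linear map xproj. *)
Record extform (R : realType) (V : lmodType R) := ExtForm {
  xdim : nat;
  num_ineqs : nat;
  num_eqs : nat;
  ineq_lhs : 'M[R]_(num_ineqs, xdim);
  ineq_rhs : 'cV[R]_num_ineqs;
  eq_lhs : 'M[R]_(num_eqs, xdim);
  eq_rhs : 'cV[R]_num_eqs;
  xproj : {linear 'cV[R]_xdim -> V} }.

Definition xpolyhedron (R : realType) (V : lmodType R) (X : extform V) :
  set 'cV[R]_(xdim X) :=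
  [set y | (forall i, (ineq_lhs X *m y) i 0 <= ineq_rhs X i 0) /\
           eq_lhs X *m y = eq_rhs X].

Definition is_extended_formulation (R : realType) (V : lmodType R)
    (X : extform V) (P : set V) : Prop :=
  @xproj R V X @` @xpolyhedron R V X = P.

Definition xsize (R : realType) (V : lmodType R) (X : extform V) : nat :=
  num_ineqs X.

(* Main.v *)
(** Martin's formulation: for every root [r], orient the edges fractionally so
    that every vertex other than [r] has out-weight 1, [r] has out-weight 0, and
    the two orientations of an edge [e] add up to [x e].  A spanning tree gives
    such orientations by directing its edges towards [r].  Conversely, choosing
    [r] in a vertex set [S] and summing the out-weights over [S] gives the
    subtour inequality x(E[S]) <= |S| - 1, so it remains to prove that the
    subtour polytope is the convex hull of spanning trees (Edmonds).  A minimal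
    tight set spanning a fractional edge spans a second one, and by uncrossing
    all tight sets contain both edges or neither; shifting weight between them
    in both directions until a new constraint becomes tight writes the point as
    a convex combination of points with more tight constraints.  Integral
    points of the subtour polytope are spanning trees. *)
From HB Require Import structures.
Require Import Defs.
From mathcomp Require Import all_boot all_order all_algebra.
From mathcomp Require Import classical_sets reals.
From mathcomp Require Import fintype finset ring lra zify.

Set Implicit Arguments.
Unset Strict Implicit.
Unset Printing Implicit Defensive.

Import Order.TTheory GRing.Theory Num.Theory.
Local Open Scope ring_scope.

(** * Convex hulls, linear systems and the ratio test *)

Lemma convex_hull_conv (R : realType) (V : lmodType R) (S : set V) (t : R)
    (x y : V) :
  0 <= t <= 1 -> convex_hull S x -> convex_hull S y ->
  convex_hull S (t *: x + (1 - t) *: y).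
Proof.
move=> /andP[t0 t1] [k [w [p [w0 w1 pS ->]]]] [l [w' [p' [w0' w1' pS' ->]]]].
exists (k + l)%N.
exists (fun i => match split i with inl j => t * w j | inr j => (1 - t) * w' j end).
exists (fun i => match split i with inl j => p j | inr j => p' j end).
split.
- by move=> i; case: (split i) => j; rewrite mulr_ge0// subr_ge0.
- rewrite big_split_ord/=.
  under eq_bigr do rewrite (unsplitK (inl _)).
  under [X in _ + X]eq_bigr do rewrite (unsplitK (inr _)).
  by rewrite -!mulr_sumr w1 w1' !mulr1 subrKC.
- by move=> i; case: (split i).
- rewrite big_split_ord/=.
  under [in RHS]eq_bigr do rewrite (unsplitK (inl _)) -scalerA.
  under [X in _ = _ + X]eq_bigr do rewrite (unsplitK (inr _)) -scalerA.
  by rewrite -!scaler_sumr.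
Qed.

(** The projection of a polyhedron is convex, so lifting the generators is enough. *)
Lemma convex_hull_sub_xproj (R : realType) (V : lmodType R) (X : extform V)
    (S : set V) :
  (forall v, S v -> exists2 y, @xpolyhedron R V X y & @xproj R V X y = v) ->
  forall v, convex_hull S v -> exists2 y, @xpolyhedron R V X y & @xproj R V X y = v.
Proof.
move=> SX v [k [w [p [w0 w1 pS ->]]]].
have /fin_all_exists[y yP] : forall i, exists y, @xpolyhedron R V X y /\ @xproj R V X y = p i.
  by move=> i; have [y ? ?] := SX _ (pS i); exists y.
exists (\sum_(i < k) w i *: y i); last first.
  by rewrite linear_sum; apply: eq_bigr => i _; rewrite linearZ (yP i).2.
split=> [i|].
  rewrite mulmx_sumr summxE -[leRHS]mul1r -w1 mulr_suml ler_sum// => j _.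
  by rewrite -scalemxAr mxE ler_wpM2l// (yP j).1.1.
rewrite mulmx_sumr -[RHS]scale1r -w1 scaler_suml; apply: eq_bigr => j _.
by rewrite -scalemxAr (yP j).1.2.
Qed.

Lemma linear_cVE (R : realType) (d : nat) (f : 'cV[R]_d -> R^o) (y : 'cV[R]_d) :
  linear f -> f y = \sum_(k < d) f (delta_mx k 0) * y k 0.
Proof.
move=> lf.
pose g : {linear 'cV[R]_d -> R^o} := HB.pack f (GRing.isLinear.Build R 'cV[R]_d R^o _ f lf).
rewrite [y in LHS]matrix_sum_delta -[f]/(g : _ -> _) linear_sum.
apply: eq_bigr => k _; rewrite big_ord1 linearZ/=.
by rewrite [LHS]mulrC.
Qed.

(** Lets a system be given by linear functionals indexed by finite types. The matrix rows are their
    values on the unit vectors, and only [I] counts towards the size. *)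
Lemma extform_of_linear (R : realType) (V : lmodType R) (d : nat)
    (p : {linear 'cV[R]_d -> V}) (I J : finType)
    (A : I -> 'cV[R]_d -> R^o) (a : I -> R)
    (B : J -> 'cV[R]_d -> R^o) (b : J -> R) :
  (forall i, linear (A i)) -> (forall j, linear (B j)) ->
  exists X : extform V, xsize X = #|I| /\
    forall v, (exists2 y, @xpolyhedron R V X y & @xproj R V X y = v) <->
      exists y, [/\ forall i, A i y <= a i, forall j, B j y = b j & p y = v].
Proof.
move=> lA lB.
exists (ExtForm (\matrix_(i < #|I|, k < d) A (enum_val i) (delta_mx k 0))
  (\col_i a (enum_val i))
  (\matrix_(j < #|J|, k < d) B (enum_val j) (delta_mx k 0))
  (\col_j b (enum_val j)) p); split=> // v.
have AE y i : (\matrix_(i < #|I|, k < d) A (enum_val i) (delta_mx k 0) *m y) i 0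
    = A (enum_val i) y.
  by rewrite mxE [RHS]linear_cVE//; apply: eq_bigr => k _; rewrite mxE.
have BE y i : (\matrix_(i < #|J|, k < d) B (enum_val i) (delta_mx k 0) *m y) i 0
    = B (enum_val i) y.
  by rewrite mxE [RHS]linear_cVE//; apply: eq_bigr => k _; rewrite mxE.
split=> [[y /= [Ay By] pv]|[y [Ay By pv]]]; exists y => //.
  split=> // [i|j].
    by have := Ay (enum_rank i); rewrite AE mxE enum_rankK.
  by have /matrixP/(_ (enum_rank j) 0) := By; rewrite BE mxE enum_rankK.
split=> /= [i|]; first by rewrite AE mxE.
by apply/matrixP => j k; rewrite (ord1 k) BE mxE.
Qed.

(** Read [s] as slacks and [t] as their rates of change. The step is the least [s i / - t i] over
    the decreasing slacks; it is positive because no vanishing slack changes. *)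
Lemma ratio_test (R : realType) (I : finType) (s t : I -> R) :
  (forall i, 0 <= s i) -> (forall i, s i = 0 -> t i = 0) ->
  (exists i, t i < 0) ->
  exists eps : R, [/\ 0 < eps, forall i, 0 <= s i + eps * t i
    & exists2 i, s i != 0 & s i + eps * t i = 0].
Proof.
move=> s0 st [i0 ti0].
case: (@arg_minP _ _ _ i0 (fun i => t i < 0) (fun i => s i / - t i)) => //= i ti imin.
have si : 0 < s i.
  by rewrite lt_neqAle s0 andbT eq_sym; apply: contraTneq ti => /st ->; rewrite ltxx.
exists (s i / - t i); split.
- by rewrite divr_gt0// oppr_gt0.
- move=> j; have [tj|tj] := ltP (t j) 0; last first.
    by rewrite addr_ge0// mulr_ge0// divr_ge0// oppr_ge0 ltW.
  rewrite -[t j]opprK mulrN subr_ge0 -ler_pdivlMr ?oppr_gt0//; exact: imin.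
- exists i; first by rewrite gt_eqF.
  by rewrite invrN mulrN mulNr divfK ?subrr// lt_eqF.
Qed.

(** * Parent maps towards a root, and cycles *)

Lemma parent_map (T : finType) (e : rel T) (r : T) :
  (forall v, connect e v r) ->
  exists (p : T -> T) (d : T -> nat),
    forall v, v != r -> e v (p v) /\ (d (p v) < d v)%N.
Proof.
move=> er.
pose reach v n := [exists q : n.-tuple T, path e v q && (last v q == r)].
have reachP v : exists n, reach v n.
  have /connectP[q eq rq] := er v.
  by exists (size q); apply/existsP; exists (in_tuple q); rewrite eq rq /=.
(* The distance to [r]; [p v] is taken to be the second vertex of a shortest path from [v], with an
   arbitrary value at the root. *)
pose d v := ex_minn (reachP v).
have /fin_all_exists[p pP] : forall v, exists w, v != r -> e v w /\ (d w < d v)%N.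
  move=> v; have [->|vr] := eqVneq v r; first by exists r.
  rewrite {2}/d; case: ex_minnP => [[|n]] /existsP[q /andP[]].
    by rewrite (tuple0 q)/= (negPf vr).
  case/tupleP: q => w q /= /andP[evw ewq] lq _; exists w => _; split=> //.
  rewrite /d; case: ex_minnP => m _ /(_ n); rewrite ltnS; apply.
  by apply/existsP; exists q; rewrite ewq.
by exists p, d.
Qed.

Lemma connect_parent (T : finType) (r : T) (p : T -> T) (d : T -> nat) :
  (forall v, v != r -> (d (p v) < d v)%N) ->
  forall v, connect (fun u w => (u != r) && (w == p u)) v r.
Proof.
move=> dp v; have [k] := ubnP (d v); elim: k v => // k IH v; rewrite ltnS => vk.
have [->|vr] := eqVneq v r; first exact: connect0.
apply: connect_trans (IH (p v) (leq_trans (dp v vr) vk)).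
by apply: connect1; rewrite vr eqxx.
Qed.

(** Hence the pairs [{u, next c u}] along a cycle with at least three vertices are distinct. *)
Lemma next_next_neq (T : eqType) (c : seq T) (u : T) :
  uniq c -> (2 < size c)%N -> u \in c -> next c (next c u) != u.
Proof.
move=> cU c2 uc; have [i c' cE] := rot_to uc.
rewrite -!(next_rot i cU) cE.
have : uniq (rot i c) by rewrite rot_uniq.
have : (2 < size (rot i c))%N by rewrite size_rot.
rewrite cE; case: c' {cE} => [|a [|b c']] //= _.
rewrite !inE !negb_or -!andbA => /and5P[ua ub _ ab _].
by rewrite eqxx [a == u]eq_sym (negPf ua) eqxx eq_sym.
Qed.

(** * Edges and their ends *)

Section Graph.
Variable G : sgraph.

Lemma edge_endsP (e : edge G) :
  exists q : G * G, adj q.1 q.2 && (val e == [set q.1; q.2]).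
Proof.
case: e => e /=; rewrite inE => /existsP[u /existsP[v uv]].
by exists (u, v).
Qed.

(** Fixes an arbitrary order of the two ends, so that [(e, b)] encodes [e] oriented out of
    [endpoint e b]. *)
Definition endpoint (e : edge G) (b : bool) : G :=
  let q := xchoose (edge_endsP e) in if b then q.1 else q.2.

Lemma val_edge e : val e = [set endpoint e true; endpoint e false].
Proof. by rewrite /endpoint; have /andP[_ /eqP] := xchooseP (edge_endsP e). Qed.

Lemma val_edgeb e b : val e = [set endpoint e b; endpoint e (~~ b)].
Proof. by case: b; rewrite val_edge// setUC. Qed.

Lemma endpoint_neq e : endpoint e true != endpoint e false.
Proof.
rewrite /endpoint; have /andP[+ _] := xchooseP (edge_endsP e).
by apply: contraTneq => ->; rewrite adj_irrefl.
Qed.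

Lemma endpoint_inj e : injective (endpoint e).
Proof.
by move=> [] [] //; move: (endpoint_neq e) => /[swap] ->; rewrite eqxx.
Qed.

Lemma edge_in_sub (e : edge G) (S : {set G}) :
  (val e \subset S) = (endpoint e true \in S) && (endpoint e false \in S).
Proof. by rewrite val_edge subUset !sub1set. Qed.

Lemma card_edge (e : edge G) : #|val e| = 2.
Proof. by rewrite val_edge cards2 endpoint_neq. Qed.

Lemma edge_eqP (e : edge G) u v : val e = [set u; v] ->
  exists b, endpoint e b = u /\ endpoint e (~~ b) = v.
Proof.
move=> euv.
have : u \in val e by rewrite euv !inE eqxx.
have : v \in val e by rewrite euv !inE eqxx orbT.
rewrite val_edge !inE => /orP[]/eqP ev /orP[]/eqP eu.
- by have := card_edge e; rewrite euv eu ev setUid cards1.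
- by exists false.
- by exists true.
- by have := card_edge e; rewrite euv eu ev setUid cards1.
Qed.

Lemma adj_inP (F : {set edge G}) u v :
  reflect (exists2 e : edge G, e \in F & val e = [set u; v]) (adj_in F u v).
Proof.
apply: (iffP existsP) => [[e /andP[eF /eqP ev]]|[e eF ev]]; exists e => //.
by rewrite eF ev /=.
Qed.

Lemma adj_in_sym (F : {set edge G}) : symmetric (adj_in F).
Proof. by move=> u v; apply/adj_inP/adj_inP => -[e eF]; rewrite setUC; exists e. Qed.

End Graph.

(** * The subtour polytope and Edmonds' theorem *)

Section Subtour.
Variables (R : realType) (G : sgraph).
Implicit Types (x d : edge G -> R) (S D : {set G}).

(** All inequalities are indexed by one finite type, so that tight ones can be counted. For empty
    [A] the truncated predecessor gives the trivial constraint 0 <= 0. *)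
Definition slack x (c : edge G + {set G}) : R :=
  match c with
  | inl e => x e
  | inr A => (#|A|.-1)%:R - \sum_(e : edge G | val e \subset A) x e
  end.

(** With no vertices the last two conditions would hold, although there is no spanning tree. *)
Definition subtour x :=
  [/\ (0 < #|G|)%N, \sum_e x e = (#|G|.-1)%:R & forall c, 0 <= slack x c].

Lemma sum_in_sub x S : \sum_(e : edge G | val e \subset S) x e =
  \sum_(e : edge G) if val e \subset S then x e else 0.
Proof. exact: big_mkcond. Qed.

Lemma subtour_ge0 x e : subtour x -> 0 <= x e.
Proof. by case=> _ _ /(_ (inl e)). Qed.

Lemma subtour_set x S : subtour x ->
  \sum_(e : edge G | val e \subset S) x e <= (#|S|.-1)%:R.
Proof. by case=> _ _ /(_ (inr S)); rewrite subr_ge0. Qed.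

Lemma subtour_le1 x e : subtour x -> x e <= 1.
Proof.
move=> xP; have := subtour_set (val e) xP; rewrite card_edge; apply: le_trans.
by rewrite (bigD1 e)//= lerDl sumr_ge0// => f _; apply: subtour_ge0.
Qed.

Lemma slack_setT x : subtour x -> slack x (inr [set: G]) = 0.
Proof.
case=> _ sx _ /=; rewrite cardsT -sx; apply/eqP; rewrite subr_eq0; apply/eqP.
by apply: eq_bigl => e; rewrite subsetT.
Qed.

(** Uncrossing: the right-hand sides are modular on sets that meet and the edge sums are
    supermodular, so the constraints of the intersection and the union must both be tight. *)
Lemma tight_setI x S D : subtour x -> S :&: D != set0 ->
  slack x (inr S) = 0 -> slack x (inr D) = 0 -> slack x (inr (S :&: D)) = 0.
Proof.
move=> xP SD /= /eqP + /eqP; rewrite !subr_eq0 => /eqP xS /eqP xD.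
apply/eqP; rewrite eq_le subr_le0 subr_ge0 subtour_set// andbT.
have cSD : #|S :&: D|.-1%:R + #|S :|: D|.-1%:R = #|S|.-1%:R + #|D|.-1%:R :> R.
  rewrite -!natrD; congr (_%:R); have := cardsUI S D.
  have : (0 < #|S :&: D|)%N by rewrite card_gt0.
  have := subset_leq_card (subsetIl S D).
  have := subset_leq_card (subsetIr S D).
  lia.
have sSD : \sum_(e : edge G | val e \subset S) x e +
    \sum_(e : edge G | val e \subset D) x e <=
    \sum_(e : edge G | val e \subset S :&: D) x e +
    \sum_(e : edge G | val e \subset S :|: D) x e.
  rewrite !sum_in_sub -[leLHS]big_split -[leRHS]big_split.
  rewrite ler_sum//= => e _.
  have xe := subtour_ge0 e xP.
  rewrite subsetI; case eS: (val e \subset S); case eD: (val e \subset D) => /=.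
  - by rewrite (subset_trans eS (subsetUl S D)).
  - by rewrite (subset_trans eS (subsetUl S D)) addr0 add0r.
  - by rewrite (subset_trans eD (subsetUr S D)).
  - by rewrite !add0r; case: ifP.
have := subtour_set (S :|: D) xP.
lra.
Qed.

(* The edges of an integral point inside a vertex set closed under adjacency
   and inside its complement would number at most [#|G| - 2]. *)
Lemma integral_connected (F : {set edge G}) :
  subtour (fun e => (e \in F)%:R) -> connected_graph (adj_in F).
Proof.
move=> xP; have [G0 sx _] := xP; split=> // u v.
apply/negPn/negP => uv.
pose S := [set w | connect (adj_in F) u w].
have uS : u \in S by rewrite inE connect0.
have vS : v \in ~: S by rewrite !inE.
have : \sum_e ((e \in F)%:R : R) <= #|S|.-1%:R + #|~: S|.-1%:R.
  apply: le_trans (lerD (subtour_set S xP) (subtour_set (~: S) xP)).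
  rewrite !sum_in_sub -[leRHS]big_split ler_sum//= => e _.
  case eF: (e \in F); last by rewrite !if_same addr0.
  have ab : adj_in F (endpoint e true) (endpoint e false).
    by apply/adj_inP; exists e; rewrite // -val_edge.
  rewrite !edge_in_sub !inE.
  have -> : connect (adj_in F) u (endpoint e true) =
            connect (adj_in F) u (endpoint e false).
    by apply: (same_connect_r (sym_connect_sym (@adj_in_sym _ F)) (connect1 ab)).
  by case: connect; rewrite /= ?addr0 ?add0r.
rewrite sx -natrD ler_nat.
have := cardsC S; have : (0 < #|S|)%N by apply/card_gt0P; exists u.
have : (0 < #|~: S|)%N by apply/card_gt0P; exists v.
lia.
Qed.

(** A cycle on k vertices puts k edges of [F] inside its vertex set, against the bound k - 1. *)
Lemma integral_acyclic (F : {set edge G}) :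
  subtour (fun e => (e \in F)%:R) -> acyclic_graph (adj_in F).
Proof.
move=> xP c /andP[cF cU]; rewrite ltnNge; apply/negP => c2.
pose S := [set w in c]; pose E := [set e in F | val e \subset S].
have := subtour_set S xP.
have -> : \sum_(e : edge G | val e \subset S) ((e \in F)%:R : R) = #|E|%:R.
  rewrite -sum1_card natr_sum big_mkcond [RHS]big_mkcond; apply: eq_bigr => e _.
  by rewrite inE; case: (e \in F); case: ifP.
have cS : #|S| = size c by rewrite cardsE; apply/card_uniqP.
rewrite ler_nat; suff : (#|S| <= #|E|)%N by rewrite cS; move: c2; lia.
have <- : #|[set [set u; next c u] | u in S]| = #|S|.
  apply: card_in_imset => u v; rewrite !inE => uc vc uv.
  have : u \in [set v; next c v] by rewrite -uv !inE eqxx.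
  have : v \in [set u; next c u] by rewrite uv !inE eqxx.
  rewrite !inE => /orP[/eqP->//|/eqP vu] /orP[/eqP->//|/eqP uv'].
  by have := next_next_neq cU c2 uc; rewrite -vu -uv' eqxx.
rewrite -(card_imset (mem E) val_inj); apply: subset_leq_card.
apply/subsetP => _ /imsetP[u + ->]; rewrite inE => uc.
have /adj_inP[e eF eu] := next_cycle cF uc.
apply/imsetP; exists e => //; rewrite inE eF eu subUset !sub1set !inE uc.
by rewrite mem_next.
Qed.

Definition fractional x e := (x e != 0) && (x e != 1).

(** The edge values inside a tight set add up to an integer, so exactly one of them cannot be
    fractional. *)
Lemma tight_fractional_pair x D (e : edge G) : subtour x ->
  slack x (inr D) = 0 -> val e \subset D -> fractional x e ->
  exists f : edge G, [/\ f != e, val f \subset D & fractional x f].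
Proof.
move=> xP /eqP; rewrite subr_eq0 => /eqP xD eD /andP[e0 e1].
have [/existsP[f /and3P[]]|] :=
  boolP [exists f : edge G, [&& f != e, val f \subset D & fractional x f]].
  by exists f.
move=> /existsPn fP; exfalso.
have : exists k : nat,
    \sum_(f : edge G | (val f \subset D) && (f != e)) x f = k%:R.
  (* The other values are all 0 or 1, and the witness counts the ones. *)
  exists (\sum_(f : edge G | (val f \subset D) && (f != e)) (x f == 1%R) : nat)%N.
  rewrite natr_sum; apply: eq_bigr => f /andP[fD fe].
  have := fP f; rewrite fe fD /fractional /= negb_and !negbK /= => /orP[]/eqP ->.
    by rewrite eq_sym oner_eq0.
  by rewrite eqxx.
move: xD; rewrite (bigD1 e)//= => + [k kE]; rewrite kE => xe.
have : 0 < x e by rewrite lt_neqAle eq_sym e0 subtour_ge0.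
have : x e < 1 by rewrite lt_neqAle e1 subtour_le1.
move=> x1 x0.
have : (k%:R : R) < (#|D|.-1)%:R by lra.
have : ((#|D|.-1)%:R : R) < k.+1%:R by rewrite -natr1; lra.
rewrite !ltr_nat; lia.
Qed.

(* By uncrossing, every tight set containing one edge of a minimal tight set
   [D] with fractional edges contains [D], hence all its edges. *)
Lemma tight_twins x (e : edge G) : subtour x -> fractional x e ->
  exists f g : edge G, [/\ f != g, fractional x f, fractional x g &
    forall S, slack x (inr S) = 0 -> (val f \subset S) = (val g \subset S)].
Proof.
move=> xP xe.
pose P D := (slack x (inr D) == 0) &&
  [exists f : edge G, (val f \subset D) && fractional x f].
have PT : P [set: G].
  by rewrite /P slack_setT// eqxx; apply/existsP; exists e; rewrite subsetT.
case: (@arg_minnP _ _ P (fun D => #|D|) PT) => D /andP[/eqP tD].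
move=> /existsP[f /andP[fD xf]] Dmin.
have [g [gf gD xg]] := tight_fractional_pair xP tD fD xf.
have DS (h : edge G) S : slack x (inr S) = 0 -> val h \subset D -> fractional x h ->
    val h \subset S -> D \subset S.
  move=> tS hD xh hS; have hSD : val h \subset S :&: D by rewrite subsetI hS.
  have SD0 : S :&: D != set0.
    by apply: contraTneq hSD => ->; rewrite subset0 -cards_eq0 card_edge.
  have tSD : slack x (inr (S :&: D)) = 0 by apply: tight_setI.
  (* The intersection is tight and contains the fractional edge [h], so minimality of [D] applies to
     it. *)
  have : S :&: D == D.
    rewrite eqEcard subsetIr Dmin// /P tSD eqxx.
    by apply/existsP; exists h; rewrite hSD.
  by move=> /eqP <-; apply: subsetIl.
exists f, g; split=> //; first by rewrite eq_sym.
move=> S tS; apply/idP/idP => hS.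
  exact: subset_trans gD (DS f S tS fD xf hS).
exact: subset_trans fD (DS g S tS gD xg hS).
Qed.

Definition nonzero_slacks x := #|[set c | slack x c != 0]|.

Definition swap (f g : edge G) : edge G -> R :=
  fun e => (e == f)%:R - (e == g)%:R.

Lemma sum_swap (P : pred (edge G)) f g :
  \sum_(e | P e) swap f g e = (P f)%:R - (P g)%:R.
Proof.
have sumE h : \sum_(e | P e) ((e == h)%:R : R) = (P h)%:R.
  rewrite big_mkcond (bigD1 h)//= eqxx big1 ?addr0; last first.
    by move=> e /negPf ->; rewrite if_same.
  by case: (P h).
by rewrite big_split/= sumrN !sumE.
Qed.

(** Moving weight from [g] to [f] changes no tight constraint, as tight sets do not separate the two
    edges; the ratio test then stops at a newly tight one. *)
Lemma subtour_move x f g : subtour x -> fractional x g -> fractional x f ->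
  f != g ->
  (forall S, slack x (inr S) = 0 -> (val f \subset S) = (val g \subset S)) ->
  exists eps : R, [/\ 0 < eps, subtour (fun e => x e + eps * swap f g e) &
    (nonzero_slacks (fun e => (x e + eps * swap f g e)%R) < nonzero_slacks x)%N].
Proof.
move=> xP /andP[xg0 _] /andP[xf0 _] fg twins.
(* The rate of change of each slack under the move. *)
pose t (c : edge G + {set G}) : R := match c with
  | inl e => swap f g e
  | inr A => (val g \subset A)%:R - (val f \subset A)%:R end.
have slackE eps c : slack (fun e => x e + eps * swap f g e) c = slack x c + eps * t c.
  case: c => [//|S] /=; rewrite big_split/= -mulr_sumr sum_swap.
  by rewrite opprD addrA -mulrN opprB.
have [G0 sx x0] := xP.
have xt c : slack x c = 0 -> t c = 0.
  case: c => [e /= xe|S /twins /= ->]; last by rewrite subrr.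
  rewrite /= /swap; case: eqP => [ef|_]; first by rewrite -ef xe eqxx in xf0.
  case: eqP => [eg|_]; first by rewrite -eg xe eqxx in xg0.
  by rewrite subrr.
have [|eps [eps0 sP [c0 sc0 tc0]]] := ratio_test x0 xt.
  by exists (inl g); rewrite /= /swap eqxx eq_sym (negPf fg) sub0r oppr_lt0 ltr01.
exists eps; split=> //.
  split=> // [|c]; last by rewrite slackE.
  by rewrite big_split -mulr_sumr sum_swap/= subrr mulr0 addr0.
apply: proper_card; apply/properP; split.
  apply/subsetP => c; rewrite !inE slackE; apply: contra => /eqP sc.
  by rewrite sc xt// mulr0 addr0.
by exists c0; rewrite !inE ?slackE ?tc0 ?eqxx.
Qed.

(** Induction on the number of constraints that are not tight. *)
Lemma subtour_hull x : subtour x ->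
  spanning_tree_polytope [ffun e => x e : R^o].
Proof.
have [k] := ubnP (nonzero_slacks x); elim: k x => // k IH x; rewrite ltnS => xk xP.
have [/existsP[e xe]|/existsPn xint] := boolP [exists e, fractional x e].
  have [f [g [fg xf xg tw]]] := tight_twins xP xe.
  have [a [a0 aP ak]] := subtour_move xP xg xf fg tw.
  have gf : g != f by rewrite eq_sym.
  have [b [b0 bP bk]] := subtour_move xP xf xg gf (fun S tS => esym (tw S tS)).
  have ha := IH _ (leq_trans ak xk) aP.
  have hb := IH _ (leq_trans bk xk) bP.
  have ab0 : a + b != 0 by rewrite gt_eqF// addr_gt0.
  (* The displacements are [a] and [-b] times [swap f g]; the weights [b / (a + b)] and
     [a / (a + b)] cancel them. *)
  have t01 : 0 <= b / (a + b) <= 1.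
    rewrite divr_ge0 ?addr_ge0 ?(ltW a0) ?(ltW b0)//=.
    by rewrite ler_pdivrMr ?addr_gt0// mul1r lerDr ltW.
  have := convex_hull_conv t01 ha hb.
  congr (convex_hull _ _); apply/ffunP => h; rewrite !ffunE /swap.
  rewrite /GRing.scale/=; field.
  by [].
(* No value is fractional, so [x] is the characteristic vector of [F], a convex combination with one
   term. *)
pose F := [set e | x e == 1].
have xF e : x e = (e \in F)%:R.
  by have := xint e; rewrite inE /fractional negb_and !negbK => /orP[]/eqP ->;
    rewrite ?eqxx // eq_sym oner_eq0.
have FP : subtour (fun e => (e \in F)%:R).
  by have -> : (fun e => (e \in F)%:R) = x; [apply/boolp.funext => e; rewrite xF|].
exists 1%N, (fun=> 1), (fun=> charvec R F); split=> //.
- by rewrite big_ord1.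
- move=> _; exists F => //; split; [exact: integral_connected|exact: integral_acyclic].
- by rewrite big_ord1 scale1r; apply/ffunP => e; rewrite !ffunE.
Qed.

End Subtour.

(** * Martin's orientations: soundness, and existence for trees *)

Section Martin.
Variables (R : realType) (G : sgraph).
Notation arc := (edge G * bool)%type.

Definition tail (a : arc) : G := endpoint a.1 a.2.

(* In [z r], the edge [e] is sent along its orientation out of
   [endpoint e b] with weight [z r (e, b)], towards the root [r]. *)
Definition martin (x : edge G -> R) (z : G -> arc -> R) : Prop :=
  [/\ forall r a, 0 <= z r a,
      forall r e, x e = z r (e, true) + z r (e, false),
      forall r v, \sum_(a | tail a == v) z r a = (v != r)%:R
    & \sum_e x e = #|G|%:R - 1].

Lemma sum_arc (f : arc -> R) (P : pred (edge G)) :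
  \sum_(e | P e) (f (e, true) + f (e, false)) = \sum_(a : arc | P a.1) f a.
Proof.
rewrite (eq_bigr (fun e => \sum_b f (e, b))); last first.
  by move=> e _; rewrite (bigD1 true)// (big_pred1 false)//; case.
rewrite pair_big_dep; apply: eq_big => [[e b]|[e b] _] //=.
by rewrite andbT.
Qed.

Lemma sum_tail (f : arc -> R) (A : {set G}) :
  \sum_(a | tail a \in A) f a = \sum_(v in A) \sum_(a | tail a == v) f a.
Proof.
rewrite (partition_big tail (mem A))//=; apply: eq_bigr => v vA.
by apply: eq_bigl => a; case: eqP => [->|]; rewrite ?vA ?andbF.
Qed.

Lemma sum_neq (r : G) (A : {set G}) : r \in A ->
  \sum_(v in A) (v != r)%:R = (#|A|.-1)%:R :> R.
Proof.
move=> rA; rewrite (cardsD1 r) rA/= -sum1_card natr_sum big_mkcond [RHS]big_mkcond.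
by apply: eq_bigr => v _; rewrite !inE; case: (v \in A); rewrite ?andbF //=; case: eqP.
Qed.

Lemma martin_subtour x z : martin x z -> subtour x.
Proof.
move=> [z0 xz zt sx].
have G0 : (0 < #|G|)%N.
  (* The total [#|G|%:R - 1] is not truncated: for the empty graph it is -1, while the empty sum is
     0. *)
  rewrite lt0n; apply/eqP => G0; move: sx; rewrite G0 big1 => [/eqP|e _].
    by rewrite sub0r eq_sym oppr_eq0 oner_eq0.
  by have := fintype0 (endpoint e true) G0.
split=> //; first by rewrite sx -subn1 natrB.
case=> [e|A] /=.
  have /card_gt0P[r _] := G0.
  by rewrite (xz r) addr_ge0.
rewrite subr_ge0; have [->|[r rA]] := set_0Vmem A.
  rewrite big1 ?ler0n// => e; rewrite subset0 -cards_eq0 => /eqP e0.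
  by have := card_edge e; rewrite e0.
(* With the root [r] inside [A], both arcs of an edge inside [A] have their tails in [A], where the
   out-weights add up to [#|A|.-1]. *)
under eq_bigr do rewrite (xz r).
rewrite sum_arc -(sum_neq rA).
under [leRHS]eq_bigr do rewrite -(zt r).
rewrite -sum_tail big_mkcond [leRHS]big_mkcond ler_sum//= => -[e b] _.
rewrite edge_in_sub /tail/=.
by case: ifP => [/andP[? ?]|_]; [case: b; rewrite ifT|case: ifP].
Qed.

(* An edge outside the parent forest would close a cycle with the forest path
   between its ends. *)
Lemma tree_edge_parent (F : {set edge G}) (r : G) (p : G -> G) (d : G -> nat) :
  acyclic_graph (adj_in F) ->
  (forall v, v != r -> adj_in F v (p v) /\ (d (p v) < d v)%N) ->
  forall e : edge G, e \in F -> exists b, (endpoint e b != r) &&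
    (endpoint e (~~ b) == p (endpoint e b)).
Proof.
move=> acF pd e eF.
pose q u w := (u != r) && (w == p u).
pose q2 u w := q u w || q w u.
have q2_sym : symmetric q2 by move=> u w; rewrite /q2 orbC.
have q2F : subrel q2 (adj_in F).
  by move=> u w /orP[]/andP[/pd[? _] /eqP ->] //; rewrite adj_in_sym.
have qr v : connect q2 v r.
  have := connect_parent (fun u ur => (pd u ur).2) v.
  by apply: connect_sub => u w uw; apply: connect1; rewrite /q2 /q uw.
have [ab|ab] := boolP (q2 (endpoint e true) (endpoint e false)).
  by case/orP: ab; [exists true|exists false].
exfalso.
have /connectP[c0 c0P c0l] : connect q2 (endpoint e true) (endpoint e false).
  by rewrite (connect_trans (qr _))// (sym_connect_sym q2_sym).
move: c0l; case/shortenP: c0P => c cP cU _ cl.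
have cycF : ucycle (adj_in F) (endpoint e true :: c).
  rewrite /ucycle cU andbT /= rcons_path (sub_path q2F cP) -cl.
  by apply/adj_inP; exists e; rewrite // finset.setUC -val_edge.
(* Acyclicity leaves paths with at most one step: none would make the ends of [e] equal, one would
   make them parent and child. *)
have := acF _ cycF; case: c cP cl {cU cycF} => [|w [|? ?]] //=.
- by move=> _ /esym/eqP; rewrite (negPf (endpoint_neq e)).
- by move=> /andP[+ _] ew; rewrite -ew (negPf ab).
Qed.

Lemma tree_martin (F : {set edge G}) :
  is_tree (adj_in F) -> exists z, martin (fun e => (e \in F)%:R) z.
Proof.
move=> [[G0 cF] acF].
have /fin_all_exists[p pP] : forall r, exists p : G -> G, exists d : G -> nat,
    forall v, v != r -> adj_in F v (p v) /\ (d (p v) < d v)%N.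
  by move=> r; apply: parent_map.
(* The arcs from a vertex to its parent in the tree rooted at [r]. *)
pose up r (a : arc) := (tail a != r) && (endpoint a.1 (~~ a.2) == p r (tail a)).
have upE r e : (e \in F)%:R = (up r (e, true))%:R + (up r (e, false))%:R :> R.
  have [d dP] := pP r.
  have [eF|eF] := boolP (e \in F).
    have [b bP] := tree_edge_parent acF dP eF.
    have : up r (e, true) || up r (e, false) by case: b bP => H; apply/orP; [left|right].
    (* If each end were the parent of the other, [d] would decrease in both directions. *)
    have : ~~ (up r (e, true) && up r (e, false)).
      apply/negP => /andP[/andP[/dP[_ lt1] /eqP/= p1] /andP[/dP[_ lt2] /eqP/= p2]].
      by move: lt1 lt2; rewrite -p1 -p2 /tail/= => /ltnW; rewrite leqNgt => /negPf ->.
    by case: (up r _); case: (up r _) => //=; rewrite ?addr0 ?add0r.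
  have upF b : up r (e, b) -> e \in F.
    rewrite /up /tail/= => /andP[er /eqP ep].
    have [/adj_inP[f fF fe] _] := dP _ er.
    by have -> : e = f by apply: val_inj; rewrite fe -ep -val_edgeb.
  have {}upF b : up r (e, b) = false by apply: contraNF eF; apply: upF.
  by rewrite !upF addr0.
have upt r v : \sum_(a | tail a == v) (up r a)%:R = (v != r)%:R :> R.
  have [->|vr] /= := eqVneq v r.
    by rewrite big1// => a /eqP ar; rewrite /up ar eqxx.
  have [d dP] := pP r.
  have [/adj_inP[e eF ev] _] := dP _ vr.
  have [b [bv bp]] := edge_eqP ev.
  rewrite (bigD1 (e, b))/=; last by rewrite /tail bv.
  rewrite /up /tail/= bv vr bp eqxx big1 ?addr0//.
  move=> [f c] /= /andP[/eqP fv fe]; rewrite fv vr /=.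
  case: eqP => // fp; move: fe.
  have fE : f = e by apply: val_inj; rewrite ev (val_edgeb f c) fv fp.
  rewrite {}fE in fv *.
  by rewrite (@endpoint_inj _ e c b) ?eqxx// fv bv.
exists (fun r a => (up r a)%:R); split=> //.
have /card_gt0P[r _] := G0.
(* Tree edges are counted by their tails: one for every vertex other than [r]. *)
under eq_bigr do rewrite (upE r).
rewrite (sum_arc (fun a => (up r a)%:R) xpredT).
have := sum_tail (fun a => (up r a)%:R) [set: G].
under eq_bigl do rewrite inE.
move=> ->; under eq_bigr do rewrite upt.
by rewrite sum_neq ?inE// cardsT -subn1 natrB.
Qed.

End Martin.

(** * The system in matrix form and its size *)

Section Formulation.
Variables (R : realType) (G : sgraph).
Notation arc := (edge G * bool)%type.
Notation var := (edge G + G * arc)%type.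
Notation space := 'cV[R]_#|{: var}|.

Definition coord (k : var) (y : space) : R^o := y (enum_rank k) 0.

Lemma coord_linear k : linear (coord k).
Proof. by move=> c u v; rewrite /coord !mxE. Qed.

Definition edge_part (y : space) : edge_space R G :=
  [ffun e => coord (inl e) y].

Lemma edge_part_linear : linear edge_part.
Proof. by move=> c u v; apply/ffunP => e; rewrite !ffunE coord_linear. Qed.

HB.instance Definition _ :=
  GRing.isLinear.Build R space (edge_space R G) _ edge_part edge_part_linear.

Lemma sum_coord_linear (I : finType) (P : pred I) (k : I -> var) :
  linear (fun y => \sum_(i | P i) coord (k i) y : R^o).
Proof.
move=> c u v; rewrite scaler_sumr -big_split; apply: eq_bigr => i _.
exact: coord_linear.
Qed.

Definition eq_idx := (G * edge G + (G * G + unit))%type.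

Definition eq_form (j : eq_idx) (y : space) : R^o :=
  match j with
  | inl (r, e) => coord (inl e) y -
      (coord (inr (r, (e, true))) y + coord (inr (r, (e, false))) y)
  | inr (inl (r, v)) => \sum_(a | tail a == v) coord (inr (r, a)) y
  | inr (inr _) => \sum_e coord (inl e) y
  end.

Definition eq_val (j : eq_idx) : R :=
  match j with
  | inl _ => 0
  | inr (inl (r, v)) => (v != r)%:R
  | inr (inr _) => #|G|%:R - 1
  end.

Lemma eq_form_linear j : linear (eq_form j).
Proof.
case: j => [[r e]|[[r v]|_]] c y y' /=; try exact: sum_coord_linear.
rewrite !coord_linear /GRing.scale/=; ring.
Qed.

(** Only the nonnegativity of [z] is written as inequalities, one for each root, edge and
    orientation; everything else is an equation. *)
Lemma martin_extform : exists X : extform (edge_space R G),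
  xsize X = (2 * (#|edges G| * #|G|))%N /\
  forall x, (exists2 y, @xpolyhedron R _ X y & xproj X y = x) <->
    exists z, martin x z.
Proof.
have lA (i : G * arc) : linear (fun y => - coord (inr i) y : R^o).
  by move=> c u v; rewrite coord_linear opprD scalerN.
have [X [sX XP]] := extform_of_linear edge_part (fun=> 0) eq_val lA eq_form_linear.
exists X; split.
  have -> : xsize X = (#|G| * (#|edges G| * 2))%N by rewrite sX !card_prod card_bool card_sig.
  by rewrite mulnC mulnAC mulnC.
move=> x; rewrite {}XP; split=> [[y [y0 yE <-]]|[z [z0 xz zt sx]]].
  exists (fun r a => coord (inr (r, a)) y); split.
  - by move=> r a; rewrite -oppr_le0 (y0 (r, a)).
  - by move=> r e; rewrite ffunE; apply/eqP; rewrite -subr_eq0; apply/eqP; exact: (yE (inl (r, e))).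
  - by move=> r v; exact: (yE (inr (inl (r, v)))).
  - by under eq_bigr do rewrite ffunE; exact: (yE (inr (inr tt))).
pose y : space := \col_i match enum_val i with inl e => x e | inr (r, a) => z r a end.
have cE k : coord k y = match k with inl e => x e | inr (r, a) => z r a end.
  by rewrite /coord mxE enum_rankK.
exists y; split.
- by move=> [r a]; rewrite cE oppr_le0.
- case=> [[r e]|[[r v]|_]] /=.
  + by rewrite !cE (xz r) subrr.
  + by rewrite -zt; apply: eq_bigr => a _; rewrite cE.
  + by rewrite -sx; apply: eq_bigr => e _; rewrite cE.
- by apply/ffunP => e; rewrite ffunE cE.
Qed.

End Formulation.

Theorem proposition2 :
  exists C : nat, forall (R : realType) (G : sgraph),
    exists X : extform (edge_space R G),
      is_extended_formulation X (@spanning_tree_polytope R G) /\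
      (xsize X <= C * (#|edges G| * #|G|))%N.
Proof.
exists 2 => R G; have [X [sX XP]] := martin_extform R G.
exists X; split; last by rewrite sX.
apply/seteqP; split=> [x /XP[z /martin_subtour/subtour_hull]|].
  by congr (spanning_tree_polytope _); apply/ffunP => e; rewrite ffunE.
(* For the other inclusion only the characteristic vectors of spanning trees have to be lifted. *)
move=> x; apply: convex_hull_sub_xproj => _ [F FT <-].
apply/XP; have [z zP] := tree_martin R FT; exists z.
by move: zP; congr martin; apply/boolp.funext => e; rewrite ffunE.
Qed.
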